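(* Let $\mathcal{H}$ be a complex Hilbert space and let $A \in \mathcal{B}(\mathcal{H})$. Then $$w(A)\geq \frac{\|A\|}{2}+\frac{\big|\,\|\Re(A)\|-\|\Im(A)\|\,\big|}{2}.$$
   Context: $\mathcal{B}(\mathcal{H})$ denotes the algebra of all bounded linear operators on the complex Hilbert space $\mathcal{H}$, with operator norm $\|\cdot\|$ and adjoint $A^*$. The numerical radius is $w(A)=\sup\{|\langle Ax,x\rangle| : x\in\mathcal{H},\ \|x\|=1\}$. The real and imaginary parts are the operators $\Re(A)=\frac{A+A^*}{2}$ and $\Im(A)=\frac{A-A^*}{2\mathrm{i}}$. *)

(* Defs.v *)
From HB Require Import structures.
From mathcomp Require Import all_boot all_order all_algebra.
From mathcomp Require Import sesquilinear complex.
From mathcomp Require Import all_classical all_reals.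
From mathcomp Require Import topology normedtype.

Set Implicit Arguments.
Unset Strict Implicit.
Unset Printing Implicit Defensive.

Import Order.TTheory GRing.Theory Num.Theory.
Import numFieldNormedType.Exports.

Local Open Scope classical_set_scope.
Local Open Scope complex_scope.
Local Open Scope ring_scope.

(* [{dot H for Num.conj}] is the type of positive definite Hermitian forms,
   linear in the first argument and conjugate-linear in the second. *)
HB.mixin Record CompleteNormedModule_isHilbert (R : realType) (H : Type)
    of CompleteNormedModule R[i] H := {
  inner : {dot H for Num.conj} ;
  sqr_norm_inner : forall x : H, `|x| ^+ 2 = inner x x
}.

#[short(type="hilbertType")]
HB.structure Definition Hilbert (R : realType) :=
  {H of CompleteNormedModule R[i] H & CompleteNormedModule_isHilbert R H}.

(* In a normed space over [R[i]] the library norm takes its values in [R[i]];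
   they are nonnegative reals, so taking the real part loses nothing. *)
Definition rnorm (R : realType) (V : normedZmodType R[i]) (x : V) : R :=
  complex.Re `|x|.

Section Operators.
Variables (R : realType) (H : hilbertType R).
Implicit Types A : H -> H.

Definition bounded_operator A := exists M : R, forall x, rnorm (A x) <= M * rnorm x.

Definition opnorm A : R := sup [set rnorm (A x) | x in [set x | rnorm x <= 1]].

Definition numerical_radius A : R :=
  sup [set rnorm (inner (A x) x) | x in [set x | rnorm x = 1]].

(* For a bounded linear [A] and any [y], exactly one [z] satisfies the condition
   (Riesz representation); the default value [0] is then never used. *)
Definition adjoint A : H -> H :=
  fun y => xget 0 [set z | forall x, inner (A x) y = inner x z].

Definition real_part A : H -> H := fun x => 2^-1 *: (A x + adjoint A x).

Definition imag_part A : H -> H :=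
  fun x => (2 * 'i%C)^-1 *: (A x - adjoint A x).

End Operators.

(* Main.v *)
(* Write A = B + iC with B, C the real and imaginary parts.  The triangle
   inequality gives ||A|| <= ||B|| + ||C||, and since <Bx,x> and <Cx,x> are the
   real and imaginary parts of <Ax,x>, self-adjointness of B and C gives
   max(||B||, ||C||) <= w(A); finally
   max(b, c) = (b + c) / 2 + |b - c| / 2.
   The adjoint exists by the Riesz representation theorem, obtained by minimizing
   ||x||^2 - 2 Re f(x), with everything phrased in the real inner product
   Re <x, y>. *)
Require Import Defs.
From mathcomp Require Import all_boot all_order all_algebra.
From mathcomp Require Import sesquilinear complex.
From mathcomp Require Import all_classical all_reals interval_inference.
From mathcomp Require Import topology normedtype.
From mathcomp Require Import ring lra.

Import Order.TTheory GRing.Theory Num.Theory.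
Import numFieldNormedType.Exports.
Local Open Scope ring_scope.

(** Evaluate at the vertex [- b / a]. This one fact yields Cauchy-Schwarz, the Riesz minimality
    condition and the self-adjoint norm bound. *)
Lemma discriminant_le (R : realFieldType) (a b c : R) :
  0 <= a -> (forall t, 0 <= a * t ^+ 2 + 2 * b * t + c) -> b ^+ 2 <= a * c.
Proof.
rewrite le_eqVlt => /predU1P[<- q_ge0|a_gt0 q_ge0].
  have [->|b_neq0] := eqVneq b 0; first by rewrite expr0n !mul0r.
  (* For [a = 0] the expression is affine in [t]; this [t] gives it the value -1. *)
  have := q_ge0 (- (c + 1) / (2 * b)).
  by have -> : 0 * (- (c + 1) / (2 * b)) ^+ 2 +
    2 * b * (- (c + 1) / (2 * b)) + c = -1; [field | lra].
have := q_ge0 (- b / a).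
have -> : a * (- b / a) ^+ 2 + 2 * b * (- b / a) + c = c - b ^+ 2 / a.
  by field; rewrite gt_eqF.
by rewrite subr_ge0 ler_pdivrMr // mulrC.
Qed.

(** * Real-valued norms and complex moduli *)

Section RealNorm.
Local Open Scope complex_scope.
Context {R : realType}.

Lemma rnormE {V : normedZmodType R[i]} (x : V) : (rnorm x)%:C = `|x|.
Proof. by rewrite /rnorm RRe_real // ger0_real. Qed.

Lemma rnorm_ge0 {V : normedZmodType R[i]} (x : V) : 0 <= rnorm x.
Proof. by rewrite -lecR rnormE normr_ge0. Qed.

Lemma rnormD {V : normedZmodType R[i]} (x y : V) :
  rnorm (x + y) <= rnorm x + rnorm y.
Proof. by rewrite -lecR rmorphD /= !rnormE ler_normD. Qed.

Lemma rnorm0 {V : normedZmodType R[i]} : rnorm (0 : V) = 0.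
Proof. by rewrite /rnorm normr0. Qed.

Lemma rnormN {V : normedZmodType R[i]} (x : V) : rnorm (- x) = rnorm x.
Proof. by rewrite /rnorm normrN. Qed.

Lemma rnorm_eq0 {V : normedZmodType R[i]} (x : V) : (rnorm x == 0) = (x == 0).
Proof. by rewrite -(inj_eq (@complexI R)) rnormE normr_eq0. Qed.

Lemma rnormZ {V : normedModType R[i]} (a : R[i]) (x : V) :
  rnorm (a *: x) = rnorm a * rnorm x.
Proof. by apply: complexI; rewrite rmorphM /= !rnormE normrZ. Qed.

Lemma rnormM (a b : R[i]) : rnorm (a * b) = rnorm a * rnorm b.
Proof. by apply: complexI; rewrite rmorphM /= !rnormE normrM. Qed.

Lemma rnorm_real (r : R) : rnorm (r%:C) = `|r|.
Proof. by rewrite /rnorm normc_def /= expr0n addr0 sqrtr_sqr. Qed.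

Lemma normr_Re_le (z : R[i]) : `|complex.Re z| <= rnorm z.
Proof. by rewrite -lecR rnormE normc_ge_Re. Qed.

Lemma rnorm_complexi : rnorm ('i%C : R[i]) = 1.
Proof. by rewrite /rnorm normc_def /= expr0n expr1n add0r sqrtr1. Qed.

Lemma Re_conjC (z : R[i]) : complex.Re (Num.conj z) = complex.Re z.
Proof. by case: z. Qed.

Lemma rnorm_conjC (z : R[i]) : rnorm (Num.conj z) = rnorm z.
Proof. by rewrite /rnorm norm_conjC. Qed.

Lemma rnorm_le_ReIm (z : R[i]) :
  rnorm z <= `|complex.Re z| + `|complex.Im z|.
Proof.
rewrite {1}(complexE z); apply: le_trans (rnormD _ _) _.
by rewrite rnormM !rnorm_real rnorm_complexi mul1r.
Qed.
End RealNorm.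

(** * The real inner product, Riesz representation and adjoints *)

Section HilbertSpace.
Local Open Scope complex_scope.
Context {R : realType} {H : hilbertType R}.
Implicit Types x y z : H.

Definition rinner x y : R := complex.Re (inner x y).

Lemma rinnerC x y : rinner x y = rinner y x.
Proof.
rewrite /rinner (@hermC _ _ _ _ inner) expr0 mul1r.
exact: Re_conjC.
Qed.

Lemma rinnerDl x y z : rinner (x + y) z = rinner x z + rinner y z.
Proof. by rewrite /rinner linearDl raddfD. Qed.

Lemma rinnerZl (r : R) x y : rinner (r%:C *: x) y = r * rinner x y.
Proof.
rewrite /rinner linearZl_LR /=.
by case: (inner x y) => a b /=; rewrite mul0r subr0.
Qed.

Lemma rinnerBl x y z : rinner (x - y) z = rinner x z - rinner y z.
Proof. by rewrite /rinner linearBl raddfB. Qed.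

Lemma rinnerDr x y z : rinner z (x + y) = rinner z x + rinner z y.
Proof. by rewrite !(rinnerC z) rinnerDl. Qed.

Lemma rinnerBr x y z : rinner z (x - y) = rinner z x - rinner z y.
Proof. by rewrite !(rinnerC z) rinnerBl. Qed.

Lemma rinnerZr (r : R) x y : rinner x (r%:C *: y) = r * rinner x y.
Proof. by rewrite !(rinnerC x) rinnerZl. Qed.

Lemma Im_inner x y : complex.Im (inner x y) = rinner (- 'i%C *: x) y.
Proof.
rewrite /rinner linearZl_LR /=.
by case: (inner x y) => a b /=; rewrite oppr0 mul0r mulN1r opprK add0r.
Qed.

(** [c = 1] compares the real parts and [c = - 'i] the imaginary parts. *)
Lemma inner_eq_rinner x x' y y' :
  (forall c : R[i], rinner (c *: x) y = rinner (c *: x') y') ->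
  inner x y = inner x' y'.
Proof.
move=> eq_rinner; have := eq_rinner 1; rewrite !scale1r => eqRe.
by rewrite (complexE (inner x y)) (complexE (inner x' y')) !Im_inner eq_rinner
  -!/(rinner _ _) eqRe.
Qed.

Lemma sqr_rnorm x : rnorm x ^+ 2 = rinner x x.
Proof. by rewrite /rinner -sqr_norm_inner -rnormE -rmorphXn. Qed.

Lemma rinner_le x y : `|rinner x y| <= rnorm x * rnorm y.
Proof.
rewrite -(@ler_pXn2r _ 2) ?nnegrE ?mulr_ge0 ?rnorm_ge0 // real_normK ?num_real //.
rewrite exprMn mulrC; apply: discriminant_le => [|t]; first exact: sqr_ge0.
suff -> : rnorm y ^+ 2 * t ^+ 2 + 2 * rinner x y * t + rnorm x ^+ 2 =
  rnorm (t%:C *: y + x) ^+ 2 by exact: sqr_ge0.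
rewrite !sqr_rnorm !(rinnerDl, rinnerDr, rinnerZl, rinnerZr) (rinnerC y x).
by ring.
Qed.

(** If [z] represents [f], the functional [J] below is [|x - z|^2 - |z|^2], so [z] has to be its
    minimizer. A minimizing sequence is Cauchy, and its limit is the representative. *)
Lemma riesz_representation (f : H -> R) (M : R) :
  {morph f : x y / x + y} -> (forall (r : R) x, f (r%:C *: x) = r * f x) ->
  (forall x, `|f x| <= M * rnorm x) ->
  exists z, forall x, f x = rinner x z.
Proof.
move=> fD fZ f_le.
pose J x := rnorm x ^+ 2 - 2 * f x.
have J_ge x : - M ^+ 2 <= J x.
  have := f_le x; rewrite ler_norml => /andP[_ fxM].
  by have := sqr_ge0 (rnorm x - M); rewrite /J sqrrB; lra.
have Jinf : has_inf (range J).
  by split; [exists (J 0), 0 | exists (- M ^+ 2) => _ [x _ <-]].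
pose m := inf (range J).
have m_le x : m <= J x by apply: ge_inf; [exact: Jinf.2 | exists x].
(* The linear coefficient is the defect [rinner y x - f y], which must vanish at the minimizer. *)
have JD x y t : J (x + t%:C *: y) =
    J x + (rnorm y ^+ 2 * t ^+ 2 + 2 * (rinner y x - f y) * t).
  rewrite /J !sqr_rnorm fD fZ !(rinnerDl, rinnerDr, rinnerZl, rinnerZr).
  rewrite (rinnerC x y); ring.
have /choice[u Ju] (n : nat) : exists x, J x < m + n.+1%:R^-1.
  have [|_ [x _ <-] ?] := @inf_adherent _ _ n.+1%:R^-1 _ Jinf.
    by rewrite invr_gt0.
  by exists x.
have u_cauchy n k :
    rnorm (u n - u k) ^+ 2 <= 2 * (n.+1%:R^-1 + k.+1%:R^-1).
  (* parallelogram law around the midpoint, where [J >= m] *)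
  have Jmid : m <= J (2^-1%:C *: (u n + u k)) by exact: m_le.
  move: (Ju n) (Ju k) Jmid; rewrite /J !sqr_rnorm fZ fD.
  rewrite !(rinnerBl, rinnerBr, rinnerDl, rinnerDr, rinnerZl, rinnerZr).
  rewrite (rinnerC (u k) (u n)).
  by move: n.+1%:R^-1 k.+1%:R^-1 => e1 e2; lra.
have u_cvg : cvg (u @ \oo)%classic.
  apply: cauchy_cvg; apply: cauchy_exP => e e_gt0.
  have eE : e = (complex.Re e)%:C by rewrite RRe_real // gtr0_real.
  have r_gt0 : 0 < complex.Re e by rewrite -ltcR -eE.
  move: (complex.Re e) eE r_gt0 => r {e e_gt0}-> r_gt0.
  (* Two errors below [r ^+ 2 / 4], doubled in [u_cauchy], stay below [r ^+ 2]. *)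
  have r2_gt0 : 0 < r ^+ 2 / 4 by rewrite divr_gt0 // exprn_gt0.
  have [N _ HN] := near_infty_natSinv_lt (PosNum r2_gt0).
  exists (u N); exists N => // n /= Nn; rewrite -ball_normE /= -rnormE ltcR.
  rewrite -(@ltr_pXn2r _ 2) ?nnegrE ?rnorm_ge0 ?(ltW r_gt0) //.
  apply: le_lt_trans (u_cauchy N n) _.
  move: (HN N (leqnn N)) (HN n Nn) => /=.
  by move: N.+1%:R^-1 n.+1%:R^-1 => e1 e2; lra.
exists (lim (u @ \oo)%classic) => x; apply/eqP; rewrite -subr_eq0 -normr_le0.
set l := lim _; set D := _ - _.
have D_le e : 0 < e -> `|D| <= 2 * rnorm x * e.
  move=> e_gt0.
  have e2_gt0 : 0 < e ^+ 2 by rewrite exprn_gt0.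
  have eC_gt0 : 0 < e%:C by rewrite ltcR.
  near (\oo)%classic => n.
  have un_l : rnorm (l - u n) <= e.
    rewrite -lecR rnormE; near: n; move/cvgrPdist_le : u_cvg; exact.
  have un_inv : n.+1%:R^-1 < e ^+ 2.
    by near: n; exact: (near_infty_natSinv_lt (PosNum e2_gt0)).
  (* Since [J (u n) < m + e ^+ 2] and [J >= m] along the line through [u n] in direction [x], the
     quadratic in [JD] with constant term [e ^+ 2] is nonnegative; its discriminant bounds the
     defect. *)
  have fx_un : `|rinner x (u n) - f x| <= rnorm x * e.
    rewrite -(@ler_pXn2r _ 2) ?nnegrE ?mulr_ge0 ?rnorm_ge0 ?(ltW e_gt0) //.
    rewrite real_normK ?num_real // exprMn.
    apply: discriminant_le => [|t]; first exact: sqr_ge0.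
    have := m_le (u n + t%:C *: x); rewrite JD.
    by have := lt_trans (Ju n) (ler_ltD (lexx m) un_inv); lra.
  have -> : D = - (rinner x (u n) - f x) - rinner x (l - u n).
    by rewrite /D rinnerBr; ring.
  rewrite (le_trans (ler_normB _ _)) // normrN.
  have := rinner_le x (l - u n).
  have := ler_wpM2l (rnorm_ge0 x) un_l; lra.
rewrite leNgt; apply/negP => D_gt0.
(* The [+ 1] keeps the denominator positive at [x = 0] and makes the bound from [D_le] strictly
   smaller than [|D|]. *)
have x1_gt0 : 0 < 2 * (rnorm x + 1) by have := rnorm_ge0 x; lra.
have := D_le (`|D| / (2 * (rnorm x + 1))) (divr_gt0 D_gt0 x1_gt0).
rewrite mulrA ler_pdivlMr //; have := rnorm_ge0 x; nra.
Unshelve. all: by end_near.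
Qed.

Lemma adjointP (A : {linear H -> H}) : bounded_operator A ->
  forall x y, inner (A x) y = inner x (adjoint A y).
Proof.
move=> [M A_le] x y.
have [||v|z zP] := @riesz_representation (fun v => rinner (A v) y) (M * rnorm y).
- by move=> u v; rewrite linearD rinnerDl.
- by move=> t u; rewrite linearZ rinnerZl.
- rewrite mulrAC; apply: le_trans (rinner_le _ _) _.
  by apply: ler_wpM2r (A_le v); exact: rnorm_ge0.
(* The default of [xget] is excluded: [z] satisfies the real identity, and complex linearity of [A]
   upgrades it to [inner]. *)
rewrite /adjoint; case: xgetP => [_ -> ->//|/(_ z) noz].
case: noz => v; apply: inner_eq_rinner => c.
by rewrite -linearZ zP.
Qed.

(** [S] acts as the adjoint of [T], so the half sum is the self-adjoint part of [T] and has the same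
    real quadratic form, which controls its norm. Applied to [A] and to [- 'i A]. *)
Lemma half_sum_rnorm_le (T S : H -> H) (w : R) :
  {morph T : x y / x + y} ->
  (forall x y, rinner (T x) y = rinner x (S y)) ->
  (forall x, `|rinner (T x) x| <= w * rnorm x ^+ 2) ->
  forall x, rnorm (2^-1 *: (T x + S x)) <= w * rnorm x.
Proof.
move=> TD TS T_le x; set y := 2^-1 *: _.
have half : 2^-1 = (2^-1)%:C :> R[i] by rewrite fmorphV rmorph_nat.
have TN v : T (- v) = - T v.
  have T0 : T 0 = 0 by apply: (addrI (T 0)); rewrite -TD !addr0.
  by apply: (addrI (T v)); rewrite -TD !subrr.
(* Polarization: both quadratic terms are controlled by [T_le]; then take
   [v = t y] and let [t] vary. *)
have polar v : 4 * rinner y v = rinner (T (x + v)) (x + v) -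
    rinner (T (x - v)) (x - v).
  rewrite /y half !TD TN !(rinnerBl, rinnerBr, rinnerDl, rinnerDr, rinnerZl).
  by rewrite (rinnerC (S x)) -TS; field.
have wn_ge0 v : 0 <= w * rnorm v ^+ 2 := le_trans (normr_ge0 _) (T_le v).
(* For [v = t y], [polar] and the parallelogram law give [4 t |y|^2 <= 2 w (|x|^2 + t^2 |y|^2)]. *)
have disc : (- rnorm y ^+ 2) ^+ 2 <= w * rnorm y ^+ 2 * (w * rnorm x ^+ 2).
  apply: discriminant_le => [|t]; first exact: wn_ge0.
  have := polar (t%:C *: y).
  have := T_le (x + t%:C *: y); have := T_le (x - t%:C *: y).
  rewrite !ler_norml !sqr_rnorm => /andP[+ _] /andP[_ +].
  rewrite !(rinnerBl, rinnerBr, rinnerDl, rinnerDr, rinnerZl, rinnerZr).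
  rewrite (rinnerC y x); lra.
have wx_ge0 : 0 <= w * rnorm x.
  have [x0|/eqP x_neq0] := eqVneq (rnorm x) 0; first by rewrite x0 mulr0.
  have x_gt0 : 0 < rnorm x by rewrite lt0r rnorm_ge0 andbT; apply/eqP.
  by rewrite -(pmulr_lge0 _ x_gt0) -mulrA -expr2.
have [->//|y_neq0] := eqVneq (rnorm y) 0.
have y2_gt0 : 0 < rnorm y ^+ 2 by rewrite exprn_gt0 // lt0r y_neq0 rnorm_ge0.
rewrite -(@ler_pXn2r _ 2) ?nnegrE ?rnorm_ge0 // -(ler_pM2l y2_gt0).
by apply: le_trans (le_trans disc _); rewrite le_eqVlt; apply/orP; left;
  apply/eqP; ring.
Qed.

(** * Operator norm and numerical radius as suprema *)

Lemma opnorm_le (B : H -> H) (w : R) : 0 <= w ->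
  (forall x, rnorm (B x) <= w * rnorm x) -> opnorm B <= w.
Proof.
move=> w_ge0 B_le; apply: ge_sup.
  by exists (rnorm (B 0)), 0 => //=; rewrite rnorm0 ler01.
move=> _ [x /= x_le1 <-].
by apply: le_trans (B_le x) _; rewrite ler_piMr.
Qed.

Lemma rnorm_le_opnorm (B : H -> H) (w : R) x : 0 <= w ->
  (forall x, rnorm (B x) <= w * rnorm x) -> rnorm x <= 1 ->
  rnorm (B x) <= opnorm B.
Proof.
move=> w_ge0 B_le x_le1; apply: ub_le_sup; last by exists x.
exists w => _ [v /= v_le1 <-].
by apply: le_trans (B_le v) _; rewrite ler_piMr.
Qed.

Lemma numerical_radius_ge0 (A : H -> H) : 0 <= numerical_radius A.
Proof.
rewrite /numerical_radius; set E := image _ _.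
(* If [E] is empty (trivial [H]) or unbounded, [sup] takes its default 0. *)
have [[[r rE] E_ub]|no_sup] := pselect (has_sup E); last by rewrite sup_out.
apply: le_trans (ub_le_sup E_ub rE); case: rE => x _ <-; exact: rnorm_ge0.
Qed.

(** By homogeneity: normalize a nonzero [x] and compare with the supremum over unit vectors. *)
Lemma rnorm_inner_le_numerical_radius (A : {linear H -> H}) :
  bounded_operator A ->
  forall x, rnorm (inner (A x) x) <= numerical_radius A * rnorm x ^+ 2.
Proof.
move=> [M A_le] x.
have [x0|x_neq0] := eqVneq (rnorm x) 0.
  move/eqP: (x0); rewrite rnorm_eq0 => /eqP ->.
  by rewrite linear0r !rnorm0 expr0n mulr0.
have x_gt0 : 0 < rnorm x by rewrite lt0r x_neq0 rnorm_ge0.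
set a := (rnorm x)^-1.
have a_gt0 : 0 < a by rewrite invr_gt0.
have ax1 : rnorm (a%:C *: x) = 1.
  by rewrite rnormZ rnorm_real gtr0_norm // mulVf.
have unit_le : rnorm (inner (A (a%:C *: x)) (a%:C *: x)) <= numerical_radius A.
  apply: ub_le_sup; last by exists (a%:C *: x).
  (* A crude bound suffices for the supremum to be genuine: [M] for the real part and [M] for the
     imaginary part. *)
  exists (M + M) => _ [v /= v1 <-].
  have Av_le : rnorm (A v) <= M by have := A_le v; rewrite v1 mulr1.
  apply: le_trans (rnorm_le_ReIm _) _; apply: lerD.
    by apply: le_trans (rinner_le _ _) _; rewrite v1 mulr1.
  rewrite Im_inner; apply: le_trans (rinner_le _ _) _.
  by rewrite v1 mulr1 rnormZ rnormN rnorm_complexi mul1r.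
move: unit_le; rewrite linearZr_LR linearZ linearZl_LR /= !rnormM.
rewrite rnorm_conjC rnorm_real gtr0_norm // mulrA -expr2.
by rewrite exprVn mulrC ler_pdivrMr ?exprn_gt0.
Qed.

End HilbertSpace.

Theorem theorem2p1 (R : realType) (H : hilbertType R) (A : {linear H -> H})
    (A_bounded : bounded_operator A) :
  numerical_radius A >=
    opnorm A / 2 + `| opnorm (real_part A) - opnorm (imag_part A) | / 2.
Proof.
set w := numerical_radius A.
have w_ge0 : 0 <= w := numerical_radius_ge0 _.
have adjA := adjointP A A_bounded.
have A_le := rnorm_inner_le_numerical_radius A A_bounded.
have Re_le x : rnorm (real_part A x) <= w * rnorm x.
  apply: half_sum_rnorm_le => [u v|u v|u]; first exact: linearD.
    by rewrite /rinner adjA.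
  exact: le_trans (normr_Re_le _) (A_le u).
have i_neq0 : 'i%C != 0 :> R[i] by rewrite eq_complex /= oner_eq0 andbF.
have Im_le x : rnorm (imag_part A x) <= w * rnorm x.
  (* the imaginary part of [A] is the real part of [- i A] *)
  have -> : imag_part A x = 2^-1 *: (- 'i%C *: A x + 'i%C *: adjoint A x).
    have iV : ('i%C : R[i])^-1 = - 'i%C.
      apply: (mulfI i_neq0).
      by rewrite mulfV // mulrN -expr2 sqr_i opprK.
    by rewrite /imag_part invfM iV -scalerA scalerBr
      [X in _ - X]scaleNr opprK.
  apply: (half_sum_rnorm_le (fun v => - 'i%C *: A v)
      (fun v => 'i%C *: adjoint A v)) => [u v|u v|u].
  - by rewrite linearD scalerDr.
  - rewrite /rinner linearZl_LR linearZr_LR /= adjA; congr (complex.Re (_ * _)).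
    by apply/eqP; rewrite eq_complex /= oppr0 !eqxx.
  (* The quadratic form of [- 'i A] is the imaginary part of [inner (A u) u], hence at most its
     modulus. *)
  - rewrite -Im_inner; apply: le_trans (A_le u).
    by rewrite -normrN -ReiNIm; apply: le_trans (normr_Re_le _) _;
      rewrite rnormM rnorm_complexi mulr1.
have A_sum x : A x = real_part A x + 'i%C *: imag_part A x.
  rewrite /real_part /imag_part scalerA invfM mulrCA mulfV // mulr1.
  rewrite -scalerDr addrACA subrr addr0 scalerDr -scalerDl.
  by have := splitr (1 : R[i]); rewrite mul1r => <-; rewrite scale1r.
have opnorm_A : opnorm A <= opnorm (real_part A) + opnorm (imag_part A).
  apply: ge_sup; first by exists (rnorm (A 0)), 0 => //=; rewrite rnorm0 ler01.
  move=> _ [x /= x_le1 <-]; rewrite {1}A_sum; apply: le_trans (rnormD _ _) _.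
  rewrite (rnormZ 'i%C) rnorm_complexi mul1r.
  by apply: lerD; apply: (rnorm_le_opnorm _ w).
have := opnorm_le _ _ w_ge0 Re_le; have := opnorm_le _ _ w_ge0 Im_le.
have [_|_] := ler0P (opnorm (real_part A) - opnorm (imag_part A)); lra.
Qed.
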